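(* Let $p$ be an odd prime and let $F$ be a 2-regular graph of order $p$ satisfying $\nu_3(F) \le \nu_5(F) + \sum_{i=7}^{p} \nu_i(F)$, where $\nu_m(F)$ denotes the number of $m$-cycles in $F$. Then there exists a 2-factorisation of $3K_p$ into $F$.
   Context: $\lambda K_n$ denotes the complete multigraph of order $n$ with exactly $\lambda$ distinct edges joining each pair of distinct vertices. A 2-factorisation of a (multi)graph into $F$ is a partition of its edge multiset into spanning subgraphs, each isomorphic to the 2-regular graph $F$. *)

(* Defs.v *)
From mathcomp Require Import all_boot.
Set Implicit Arguments.
Unset Strict Implicit.
Unset Printing Implicit Defensive.

Record sgraph := SGraph {
  svertex :> finType;
  adj : rel svertex;
  adj_sym : symmetric adj;
  adj_irrefl : irreflexive adj }.

Definition sedges (F : sgraph) : {set {set F}} :=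
  [set e | [exists x : F, exists y : F, adj x y && (e == [set x; y])]].

Definition regular (k : nat) (F : sgraph) : Prop :=
  forall x : F, #|[set y : F | adj x y]| = k.

(* A cycle of length at least 3 is determined by its set of edges, so m-cycles
   are counted as edge sets: the 2m closed tuples running around the same cycle
   count once. *)
Definition cycle_edges (T : finType) (c : seq T) : {set {set T}} :=
  [set [set x; next c x] | x in c].

Definition cycles (F : sgraph) (m : nat) : {set {set {set F}}} :=
  [set A | (2 < m) &&
     [exists c : m.-tuple F, ucycleb (@adj F) c && (A == cycle_edges c)]].

Definition nu (m : nat) (F : sgraph) : nat := #|cycles F m|.

Record mgraph := MGraph {
  mvertex : finType;
  medge : finType;
  ends : medge -> {set mvertex} }.

Definition mgraph_of (F : sgraph) : mgraph :=
  @MGraph F {e : {set F} | e \in sedges F} val.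

Definition spanning_subgraph (G : mgraph) (B : {set medge G}) : mgraph :=
  @MGraph (mvertex G) {e : medge G | e \in B} (fun e => ends (val e)).

Definition mgraph_iso (G H : mgraph) : Prop :=
  exists (f : mvertex G -> mvertex H) (g : medge G -> medge H),
    [/\ bijective f, bijective g
      & forall e : medge G, ends (g e) = f @: ends e].

(* The edges joining x and y are the pairs ({x, y}, i) with i < lam. *)
Definition complete_mgraph (lam n : nat) : mgraph :=
  @MGraph 'I_n ({e : {set 'I_n} | #|e| == 2} * 'I_lam)%type
    (fun e => val e.1).

Definition has_factorisation (G : mgraph) (F : sgraph) : Prop :=
  exists P : {set {set medge G}},
    partition P [set: medge G] /\
    forall B, B \in P -> mgraph_iso (spanning_subgraph B) (mgraph_of F).

(* Main.v *)
Require Import Defs.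
From mathcomp Require Import all_boot zify.
Set Implicit Arguments.
Unset Strict Implicit.
Unset Printing Implicit Defensive.

(** It is enough to decompose the circulant multigraph on Z_p with connection
    multiset {1, 2, 3} into three copies of [F]: multiplying by d = 1, ...,
    (p - 1) / 2 turns the connection multiset into {d, 2d, 3d}, and since p > 3
    each of d, 2d, 3d runs once over the nonzero residues up to sign.

    The circulant is decomposed along the line, by concatenating gadgets. A
    gadget of length n uses the edges of n consecutive positions and consists,
    in each of the three factors, of cycles of the same prescribed lengths of
    total length n. There are gadgets for a single cycle of length m >= 4 and
    for a triangle with a cycle of length m, where m = 5 or m >= 7; the
    hypothesis on [F] pairs off the triangles. The infinite families come from
    finitely many gadgets by a step that lengthens one open path in each factor
    by two vertices. *)

(** * Edge sums along paths and cycles *)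

Section Sums.
Variables (T : Type) (phi : T -> T -> nat).

Fixpoint psum (x : T) (s : seq T) : nat :=
  if s is y :: s' then phi x y + psum y s' else 0.

Definition csum (c : seq T) : nat :=
  if c is x :: s then psum x (rcons s x) else 0.

Lemma psum_cat x s1 s2 :
  psum x (s1 ++ s2) = psum x s1 + psum (last x s1) s2.
Proof. by elim: s1 x => //= y s1 IH x; rewrite IH addnA. Qed.

Lemma psum_rcons x s y : psum x (rcons s y) = psum x s + phi (last x s) y.
Proof. by rewrite -cats1 psum_cat /= addn0. Qed.

Lemma psum_rev (phi_sym : forall x y, phi x y = phi y x) y x s :
  psum y (rev (x :: s)) = phi y (last x s) + psum x s.
Proof.
elim/last_ind: s y => [|s z IH] y; first by rewrite rev_cons /=.
rewrite -rcons_cons rev_rcons /= IH last_rcons psum_rcons (phi_sym z).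
by lia.
Qed.

Lemma psum_nth x s :
  psum x s = \sum_(i < size s) phi (nth x (x :: s) i) (nth x s i).
Proof.
elim: s x => [|y s IH] x /=; first by rewrite big_ord0.
rewrite big_ord_recl /= IH; congr (_ + _); apply: eq_bigr => i _.
by congr (phi _ _); apply: set_nth_default => //=; rewrite ltnS ltnW.
Qed.

End Sums.

Lemma psum_map (T T' : Type) (f : T' -> T) phi x s :
  psum phi (f x) (map f s) = psum (fun y z => phi (f y) (f z)) x s.
Proof. by elim: s x => //= y s IH x; rewrite IH. Qed.

Lemma csum_map (T T' : Type) (f : T' -> T) phi c :
  csum phi (map f c) = csum (fun y z => phi (f y) (f z)) c.
Proof. by case: c => //= x s; rewrite -map_rcons psum_map. Qed.

Lemma eq_csum (T : Type) (phi phi' : T -> T -> nat) c :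
  phi =2 phi' -> csum phi c = csum phi' c.
Proof.
move=> E; case: c => //= x s; suff: forall z t, psum phi z t = psum phi' z t by apply.
by move=> z t; elim: t z => //= y t IH z; rewrite E IH.
Qed.

Lemma csum_next (T : eqType) (phi : T -> T -> nat) c :
  uniq c -> csum phi c = \sum_(x <- c) phi x (next c x).
Proof.
case: c => [_|x s Us]; first by rewrite big_nil.
rewrite /csum psum_nth size_rcons (big_nth x) big_mkord; apply: eq_bigr.
move=> -[i ltis] _; rewrite [nat_of_ord _]/=.
rewrite -rcons_cons nth_rcons ltis next_nth mem_nth // index_uniq //.
by rewrite nth_rcons; case: ltnP => // ges; rewrite if_same (nth_default _ ges).
Qed.

(** * Gadgets *)

(* Multisets of vertices and edges are compared through their sums against an
   arbitrary (symmetric, for edges) weight, so that boundary terms cancel. *)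

(* [debt j] lists the vertices, relative to the start of a gadget, that factor
   [j] of the preceding gadget has already visited. *)
Definition debt (j : nat) : seq nat := nth [::] [:: [::]; [:: 0; 1]; [:: 0; 2]] j.

Definition vsum (psi : nat -> nat) (C : seq (seq nat)) : nat :=
  \sum_(c <- C) \sum_(x <- c) psi x.

Definition esum (phi : nat -> nat -> nat) (C : seq (seq nat)) : nat :=
  \sum_(c <- C) csum phi c.

(* The edges of difference 2 are shifted by one position: otherwise a vertex at
   the start of a gadget would have odd degree in it. *)
Definition window (phi : nat -> nat -> nat) (n : nat) : nat :=
  \sum_(i < n) (phi i i.+1 + phi i.+1 i.+3 + phi i i.+3).

(** [T] is the inherited debt and [T'] the debt passed on. The balance is additive, so no truncated
    subtraction occurs. *)
Definition covers (n : nat) (T T' : seq nat) (C : seq (seq nat)) : Prop :=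
  forall psi, vsum psi C + \sum_(x <- T) psi x
    = \sum_(i < n) psi i + \sum_(x <- T') psi (n + x).

(** The debts at both ends agree, so gadgets concatenate in any order and a chain of total length
    [p] closes up modulo [p]. *)
Record gadget (n : nat) (C0 C1 C2 : seq (seq nat)) : Prop := Gadget {
  gadget_covers0 : covers n (debt 0) (debt 0) C0;
  gadget_covers1 : covers n (debt 1) (debt 1) C1;
  gadget_covers2 : covers n (debt 2) (debt 2) C2;
  gadget_edges : forall phi : nat -> nat -> nat,
    (forall x y, phi x y = phi y x) ->
    esum phi C0 + esum phi C1 + esum phi C2 = window phi n }.

Definition shift (n : nat) (C : seq (seq nat)) := [seq map (addn n) c | c <- C].

Lemma vsum_cat psi C C' : vsum psi (C ++ C') = vsum psi C + vsum psi C'.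
Proof. by rewrite /vsum big_cat. Qed.

Lemma esum_cat phi C C' : esum phi (C ++ C') = esum phi C + esum phi C'.
Proof. by rewrite /esum big_cat. Qed.

Lemma vsum_shift n psi C : vsum psi (shift n C) = vsum (fun x => psi (n + x)) C.
Proof. by rewrite /vsum big_map; apply: eq_bigr => c _; rewrite big_map. Qed.

Lemma esum_shift n phi C :
  esum phi (shift n C) = esum (fun x y => phi (n + x) (n + y)) C.
Proof. by rewrite /esum big_map; apply: eq_bigr => c _; rewrite csum_map. Qed.

Lemma covers_cat n n' T T' T'' C C' :
  covers n T T' C -> covers n' T' T'' C' -> covers (n + n') T T'' (C ++ shift n C').
Proof.
move=> H H' psi; rewrite vsum_cat vsum_shift big_split_ord /=.
have -> : \sum_(x <- T'') psi (n + n' + x) = \sum_(x <- T'') psi (n + (n' + x)).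
  by apply: eq_bigr => x _; rewrite addnA.
by rewrite addnAC H -addnA (addnC (\sum_(x <- T') _)) H' addnA.
Qed.

Lemma gadget_cat n n' C0 C1 C2 C0' C1' C2' :
  gadget n C0 C1 C2 -> gadget n' C0' C1' C2' ->
  gadget (n + n') (C0 ++ shift n C0') (C1 ++ shift n C1') (C2 ++ shift n C2').
Proof.
move=> [v0 v1 v2 e] [v0' v1' v2' e'].
split; [exact: covers_cat v0 v0'|exact: covers_cat v1 v1'|exact: covers_cat v2 v2'|].
move=> phi phi_sym.
have -> : window phi (n + n')
    = window phi n + window (fun x y => phi (n + x) (n + y)) n'.
  rewrite /window big_split_ord; congr (_ + _).
  by apply: eq_bigr => i _; rewrite /= !addnS.
rewrite !esum_cat !esum_shift -e // -e' // (addnACA (esum phi C0)).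
by rewrite (addnACA (esum phi C0 + _)).
Qed.

(* A partial gadget ending at position [o] in which one cycle per factor is
   still open: the paths [o :: a], [o :: b] and [o.+1 :: c], to be closed. *)
Record opened (o : nat) (TA TB TC : seq nat) (A B C : seq (seq nat))
    (a b c : seq nat) : Prop := Opened {
  opened_lasta : last o a = o.+1;
  opened_lastb : last o b = o.+2;
  opened_lastc : last o.+1 c = o.+2;
  opened_covers0 : covers o TA [:: 0; 1] (A ++ [:: o :: a]);
  opened_covers1 : covers o TB [:: 0; 2] (B ++ [:: o :: b]);
  opened_covers2 : covers o TC [:: 0; 1; 2] (C ++ [:: o.+1 :: c]);
  opened_edges : forall phi : nat -> nat -> nat,
    (forall x y, phi x y = phi y x) ->
    esum phi A + esum phi B + esum phi C
      + (psum phi o a + psum phi o b + psum phi o.+1 c) = window phi o }.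

Lemma vsum_open psi C c : vsum psi (C ++ [:: c]) = vsum psi C + \sum_(x <- c) psi x.
Proof. by rewrite vsum_cat /vsum big_seq1. Qed.

Lemma esum_open phi C c : esum phi (C ++ [:: c]) = esum phi C + csum phi c.
Proof. by rewrite esum_cat /esum big_seq1. Qed.

Ltac unroll :=
  rewrite ?(big_cons, big_nil, big_ord_recr, big_ord0, big_cat, big_rcons, big_rev);
  rewrite /= ?addnS ?addn0.

(* The new edges have differences 1 and 3 in the first two factors and twice 2
   in the third one, which is what two positions of the window provide. *)
Lemma opened_step o TA TB TC A B C a b c :
  opened o TA TB TC A B C a b c ->
  opened o.+2 TA TB TC A B C
    (rcons (rev (o :: a)) o.+3) (rev (belast o b) ++ [:: o.+1; o.+4])
    (rcons (o.+1 :: c) o.+4).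
Proof.
case=> la lb lc va vb vc e.
(* Both [a] and [b] are run backwards; the path of [b] used to end in [o.+2], which becomes its new
   start. *)
have revb : o.+2 :: rev (belast o b) = rev (o :: b).
  by rewrite (lastI o b) rev_rcons lb.
split; rewrite ?last_rcons ?last_cat //.
- move=> psi; move: (va psi); rewrite !vsum_open; unroll; lia.
- move=> psi; move: (vb psi); rewrite !vsum_open -cat_cons revb; unroll; lia.
- move=> psi; move: (vc psi); rewrite !vsum_open; unroll; lia.
move=> phi phi_sym; move: (e phi phi_sym); rewrite /window !big_ord_recr /=.
have Eb : psum phi o.+2 (rev (belast o b)) = psum phi o b.
  have := psum_rev phi_sym o.+2 o b; rewrite -revb /= lb; lia.
rewrite !psum_rcons !psum_cat Eb psum_rev // la.
have -> : last o.+2 (rev (o :: a)) = o by rewrite rev_cons last_rcons.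
have -> : last o.+2 (rev (belast o b)) = o.
  by rewrite -[LHS]/(last 0 (o.+2 :: _)) revb rev_cons last_rcons.
rewrite /= lc (phi_sym o.+2 o.+1) (phi_sym o.+3 o.+1); lia.
Qed.

(** The six edges at positions [o] and [o.+1] close the paths: one for [a], three for [b], two for
    [c]. The added vertices leave the standard debts. *)
Lemma opened_close o A B C a b c :
  opened o (debt 0) (debt 1) (debt 2) A B C a b c ->
  gadget o.+2 (A ++ [:: o :: a]) (B ++ [:: o :: b ++ [:: o.+1; o.+3]])
    (C ++ [:: o.+1 :: rcons c o.+4]).
Proof.
case=> la lb lc va vb vc e; split.
- move=> psi; move: (va psi); rewrite !vsum_open; unroll; lia.
- move=> psi; move: (vb psi); rewrite !vsum_open; unroll; lia.
- move=> psi; move: (vc psi); rewrite !vsum_open; unroll; lia.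
move=> phi phi_sym; move: (e phi phi_sym); rewrite /window !big_ord_recr /=.
rewrite !esum_open /= !psum_rcons !psum_cat la lb !last_rcons last_cat lc /=.
rewrite (phi_sym o.+1 o) (phi_sym o.+2 o.+1) (phi_sym o.+3 o).
by rewrite (phi_sym o.+4 o.+1); lia.
Qed.

(** The fifteen edges at the last five positions close the paths and form a triangle in the first
    factor; the triangles of the other factors are meant to lie in [B] and [C]. These enter with
    exchanged debts, so they change places in the result. *)
Lemma opened_close_triangle o A B C a b c :
  opened o (debt 0) (debt 2) (debt 1) A B C a b c ->
  gadget o.+4.+1 (A ++ [:: o :: a] ++ [:: [:: o.+2; o.+3; o.+4]])
    (C ++ [:: o.+1 :: c ++ [:: o.+4.+1; o.+4; o.+4.+2; o.+3]])
    (B ++ [:: o :: b ++ [:: o.+1; o.+4; o.+4.+3; o.+4.+1; o.+3]]).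
Proof.
case=> la lb lc va vb vc e; rewrite catA; split.
- move=> psi; move: (va psi); rewrite !vsum_open; unroll; lia.
- move=> psi; move: (vc psi); rewrite !vsum_open; unroll; lia.
- move=> psi; move: (vb psi); rewrite !vsum_open; unroll; lia.
move=> phi phi_sym; move: (e phi phi_sym); rewrite /window !big_ord_recr /=.
rewrite !esum_open /= !psum_rcons !psum_cat la !last_cat lb lc /=.
rewrite (phi_sym o.+1 o) (phi_sym o.+3 o) (phi_sym o.+3 o.+1) (phi_sym o.+2 o.+1).
rewrite (phi_sym o.+4 o.+2) (phi_sym o.+4.+1 o.+4) (phi_sym o.+4.+1 o.+3).
rewrite (phi_sym o.+4.+2 o.+3) (phi_sym o.+4.+3 o.+4.+1); lia.
Qed.

Lemma opened_iter t o TA TB TC A B C a b c :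
  opened o TA TB TC A B C a b c ->
  exists a' b' c', [/\ opened (o + t.*2) TA TB TC A B C a' b' c',
    size a' = size a + t.*2, size b' = size b + t.*2 & size c' = size c + t.*2].
Proof.
move=> op; elim: t => [|t [a' [b' [c' [op' sa sb sc]]]]].
  by exists a, b, c; rewrite !addn0.
have := opened_step op'; rewrite -!addnS => op''.
do 3!eexists; split; first exact: op''.
- by rewrite size_rcons size_rev /= sa; lia.
- by rewrite size_cat size_rev size_belast sb /=; lia.
- by rewrite size_rcons /= sc; lia.
Qed.

(** [lia] treats the weights as atoms, so each is rewritten with its smaller argument first. *)
Ltac orient :=
  repeat match goal with
  | phi_sym : forall x y, ?phi x y = ?phi y x |- context [?phi ?x ?y] =>
      let lt := eval vm_compute in (y < x) in
      match lt with true => rewrite (phi_sym x y) end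
  end.

Ltac concrete :=
  split => //;
  [ by move=> psi; rewrite /vsum; unroll; lia ..
  | move=> phi phi_sym; rewrite /esum /window; unroll; orient; lia ].

(* The explicit gadgets below were found by computer search. *)

Lemma gadget4 : gadget 4 [:: [:: 0; 1; 2; 3]] [:: [:: 2; 4; 3; 5]] [:: [:: 1; 3; 6; 4]].
Proof. concrete. Qed.

Lemma gadget35 : gadget 8 [:: [:: 0; 1; 2; 5; 3]; [:: 4; 6; 7]]
  [:: [:: 2; 3; 4]; [:: 5; 7; 9; 6; 8]] [:: [:: 1; 3; 6; 5; 4]; [:: 7; 8; 10]].
Proof. concrete. Qed.

Lemma gadget37 : gadget 10 [:: [:: 0; 1; 2; 4; 5; 6; 3]; [:: 7; 8; 9]]
  [:: [:: 2; 3; 5]; [:: 4; 6; 8; 11; 9; 10; 7]]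
  [:: [:: 1; 3; 4]; [:: 5; 7; 6; 9; 12; 10; 8]].
Proof. concrete. Qed.

(** The digits in this and the next three names are the cycle lengths obtained by closing at once.
    Both parities are needed, as [opened_step] preserves parity. *)
Lemma opened5 : opened 3 (debt 0) (debt 1) (debt 2) [::] [::] [::]
  [:: 0; 1; 2; 4] [:: 2; 5] [:: 1; 3; 5].
Proof. concrete. Qed.

Lemma opened6 : opened 4 (debt 0) (debt 1) (debt 2) [::] [::] [::]
  [:: 3; 0; 1; 2; 5] [:: 2; 3; 6] [:: 3; 1; 4; 6].
Proof. concrete. Qed.

Lemma opened38 : opened 6 (debt 0) (debt 2) (debt 1)
  [::] [:: [:: 1; 3; 4]] [:: [:: 2; 3; 5]]
  [:: 3; 0; 1; 2; 4; 5; 7] [:: 5; 8] [:: 4; 6; 8].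
Proof. concrete. Qed.

Lemma opened39 : opened 7 (debt 0) (debt 2) (debt 1)
  [::] [:: [:: 1; 3; 4]] [:: [:: 2; 3; 5]]
  [:: 6; 3; 0; 1; 2; 4; 5; 8] [:: 5; 6; 9] [:: 6; 4; 7; 9].
Proof. concrete. Qed.

(** * Realizable lists of cycle lengths *)

Definition realizable (ms : seq nat) : Prop :=
  exists C0 C1 C2, [/\ gadget (sumn ms) C0 C1 C2, perm_eq (shape C0) ms,
    perm_eq (shape C1) ms & perm_eq (shape C2) ms].

Lemma realizable_perm ms ms' : perm_eq ms ms' -> realizable ms -> realizable ms'.
Proof.
move=> mm' [C0 [C1 [C2 [g s0 s1 s2]]]]; exists C0, C1, C2.
by rewrite -(perm_sumn mm'); split=> //; apply: perm_trans mm'.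
Qed.

Lemma realizable_nil : realizable [::].
Proof. exists [::], [::], [::]; split=> //; concrete. Qed.

Lemma shape_shift n C : shape (shift n C) = shape C.
Proof. by rewrite /shape -map_comp; apply: eq_map => c /=; rewrite size_map. Qed.

Lemma realizable_cat ms ms' :
  realizable ms -> realizable ms' -> realizable (ms ++ ms').
Proof.
move=> [C0 [C1 [C2 [g s0 s1 s2]]]] [C0' [C1' [C2' [g' s0' s1' s2']]]].
have := gadget_cat g g'; rewrite -sumn_cat => gg'.
do 3!eexists; split; first exact: gg';
  by rewrite /shape map_cat -!/(shape _) shape_shift; apply: perm_cat.
Qed.

Lemma realizable1 m : 3 < m -> realizable [:: m].
Proof.
(* Each path has its start outside the list, and closing appends zero, two and one vertices
   respectively. *)
have close o a b c : opened o (debt 0) (debt 1) (debt 2) [::] [::] [::] a b c ->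
    (size a).+1 = o.+2 -> (size b).+3 = o.+2 -> (size c).+2 = o.+2 ->
    realizable [:: o.+2].
  move=> op sa sb sc; do 3!eexists; rewrite [sumn _]addn0.
  split; first exact: opened_close op.
  - by rewrite /= sa.
  - by rewrite /= size_cat addn2 sb.
  by rewrite /= size_rcons sc.
move=> m_gt3; case: (eqVneq m 4) => [->|m_neq4].
  by do 3!eexists; split; first exact: gadget4.
have [m_odd|m_even] := boolP (odd m).
  have [a [b [c [op sa sb sc]]]] := opened_iter (m - 5)./2 opened5.
  have Em : m = (3 + (m - 5)./2.*2).+2 by lia.
  by rewrite Em; apply: close op _ _ _; rewrite ?sa ?sb ?sc /=; lia.
have [a [b [c [op sa sb sc]]]] := opened_iter (m - 6)./2 opened6.
have Em : m = (4 + (m - 6)./2.*2).+2 by lia.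
by rewrite Em; apply: close op _ _ _; rewrite ?sa ?sb ?sc /=; lia.
Qed.

(** The lengths allowed as partner of a triangle. *)
Definition long (m : nat) : bool := (m == 5) || (6 < m).

Lemma realizable2 m : long m -> realizable [:: 3; m].
Proof.
have close o a b c x y :
    opened o (debt 0) (debt 2) (debt 1) [::] [:: x] [:: y] a b c ->
    size x = 3 -> size y = 3 ->
    (size a).+1 = o.+2 -> (size b).+4 = o -> (size c).+3 = o ->
    realizable [:: 3; o.+2].
  move=> op sx sy sa sb sc; do 3!eexists; rewrite [sumn _]/= addn0.
  split; first exact: opened_close_triangle op.
  - by rewrite /= sa (perm_catC [:: _] [:: _]).
  - by rewrite /= sy size_cat (_ : (size c + _).+1 = o.+2) //=; lia.
  by rewrite /= sx size_cat (_ : (size b + _).+1 = o.+2) //=; lia.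
(* The odd family starts at 9 and the even one at 8, which leaves 5 and 7 to explicit gadgets. *)
rewrite /long => m_long; case: (eqVneq m 5) => [->|m_neq5].
  do 3!eexists; split; first exact: gadget35; by [].
case: (eqVneq m 7) => [->|m_neq7].
  do 3!eexists; split; first exact: gadget37; by [].
have [m_odd|m_even] := boolP (odd m).
  have [a [b [c [op sa sb sc]]]] := opened_iter (m - 9)./2 opened39.
  have Em : m = (7 + (m - 9)./2.*2).+2 by lia.
  by rewrite Em; apply: close op _ _ _ _ _; rewrite ?sa ?sb ?sc /=; lia.
have [a [b [c [op sa sb sc]]]] := opened_iter (m - 8)./2 opened38.
have Em : m = (6 + (m - 8)./2.*2).+2 by lia.
by rewrite Em; apply: close op _ _ _ _ _; rewrite ?sa ?sb ?sc /=; lia.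
Qed.

(** Removing a triangle together with a long cycle lowers both counts by one. Without triangles
    every length exceeds 3 and is realized alone. *)
Lemma realizable_of_counts ms :
  all (leq 3) ms -> count_mem 3 ms <= count long ms -> realizable ms.
Proof.
have [k] := ubnP (size ms); elim: k ms => // k IH ms le_ms ge3 le_count.
case: (boolP (3 \in ms)) => [ms3|ms3].
  have : has long ms.
    by rewrite has_count; apply: leq_trans le_count; rewrite -has_count has_pred1.
  case/hasP => m msm long_m.
  have m_in : m \in rem 3 ms.
    by move/perm_to_rem: ms3 msm => /perm_mem ->; rewrite inE => /orP[/eqP m3|//];
       rewrite m3 in long_m.
  have Ems : perm_eq ms ([:: 3; m] ++ rem m (rem 3 ms)).
    by apply: perm_trans (perm_to_rem ms3) _; rewrite perm_cons perm_to_rem.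
  apply: (@realizable_perm ([:: 3; m] ++ rem m (rem 3 ms))); first by rewrite perm_sym.
  apply: realizable_cat; first exact: realizable2.
  move: (perm_size Ems) (permP Ems (pred1 3)) (permP Ems long).
  move: ge3; rewrite (perm_all _ Ems) /= long_m => /andP[_ ge3] sz c3 cl.
  have m_neq3 : (m == 3) = false by apply: contraTF long_m => /eqP->.
  move: c3 cl; rewrite /= m_neq3 => c3 cl.
  apply: IH => //; first by lia.
  by move: le_count; rewrite c3 cl !add0n !add1n.
have: all (leq 4) ms.
  apply/allP => m msm; have := allP ge3 m msm; rewrite leq_eqVlt => /orP[/eqP m3|//].
  by rewrite m3 msm in ms3.
elim: ms {IH le_ms ge3 le_count ms3} => [_|m ms IH /= /andP[m_gt3 ms_gt3]].
  exact: realizable_nil.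
exact: (realizable_cat (realizable1 m_gt3) (IH ms_gt3)).
Qed.

(** * 2-regular graphs *)

Lemma next_next_neq (T : eqType) (c : seq T) x :
  uniq c -> 2 < size c -> x \in c -> next c (next c x) != x.
Proof.
move=> Uc c_gt2 /rot_to[i s Ec]; have := Uc.
rewrite -(rot_uniq i) -!(next_rot i Uc) Ec.
move: c_gt2; rewrite -(size_rot i) Ec.
case: s {Ec} => [|y [|z s]] //= _ /andP[]; rewrite !inE !negb_or eqxx.
by case/and3P=> [xy xz _] _; rewrite (eq_sym y) (negPf xy) eqxx eq_sym.
Qed.

Lemma uniq_flatten_eq (T : eqType) (cs : seq (seq T)) c c' x :
  uniq (flatten cs) -> c \in cs -> c' \in cs -> x \in c -> x \in c' -> c = c'.
Proof.
elim: cs => //= d cs IH; rewrite cat_uniq => /and3P[_ /hasPn disj Ucs].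
have notd e : e \in cs -> x \in e -> x \in d -> False.
  move=> ecs xe xd; have /disj/negP[] // : x \in flatten cs.
  by apply/flattenP; exists e.
rewrite !inE => /orP[/eqP->|ccs] /orP[/eqP->|ccs'] // xc xc'.
- by case: (notd _ ccs' xc' xc).
- by case: (notd _ ccs xc xc').
exact: IH.
Qed.

Lemma uniq_of_flatten (T : eqType) (cs : seq (seq T)) :
  [::] \notin cs -> uniq (flatten cs) -> uniq cs.
Proof.
elim: cs => //= c cs IH; rewrite inE negb_or cat_uniq => /andP[c_neq0 /IH{}IH].
case/and3P=> _ /hasPn disj /IH ->; rewrite andbT.
case: c => // x c in c_neq0 disj *; apply/negP=> ccs.
have /disj/negP[] : x \in flatten cs by apply/flattenP; exists (x :: c); rewrite ?mem_head.
exact: mem_head.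
Qed.

Section TwoRegular.
Variables (F : sgraph) (F_reg : regular 2 F).
Implicit Type c : seq F.

(** The length bound excludes the empty list and an edge traversed back and forth. *)
Definition simple_cycle c : bool := ucycleb (@adj F) c && (2 < size c).

Lemma simple_cycle_uniq c : simple_cycle c -> uniq c.
Proof. by case/andP=> /andP[]. Qed.

Lemma adj_next c x : simple_cycle c -> x \in c -> adj x (next c x).
Proof. by case/andP=> /andP[cc _] _; apply: next_cycle. Qed.

(** The two neighbours along the cycle are distinct because its length exceeds 2, so they exhaust
    the degree. *)
Lemma adjE c x y : simple_cycle c -> x \in c ->
  adj x y = (y == next c x) || (y == prev c x).
Proof.
move=> sc xc; have Uc := simple_cycle_uniq sc.
have neq : next c x != prev c x.
  apply: contraTneq (xc) => E; apply/negP=> _.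
  have := next_next_neq Uc _ xc; rewrite E next_prev // eqxx => /(_ _)/negP.
  by case/andP: sc => _ c2 /(_ c2).
have sub : [set next c x; prev c x] \subset [set z | adj x z].
  apply/subsetP=> z; rewrite !inE => /orP[]/eqP->; first exact: adj_next.
  rewrite adj_sym; case/andP: sc => /andP[cc _] _; exact: prev_cycle.
have /eqP E : [set next c x; prev c x] == [set z | adj x z].
  by rewrite eqEcard sub F_reg cards2 neq.
by have := in_set (adj x) y; rewrite -E !inE.
Qed.

Lemma cycle_closed c x y : simple_cycle c -> x \in c -> adj x y -> y \in c.
Proof.
by move=> sc xc; rewrite (adjE _ sc xc) => /orP[]/eqP->; rewrite ?mem_next ?mem_prev.
Qed.

Lemma cycle_edgesE c e : simple_cycle c ->
  reflect (exists x y, [/\ x \in c, adj x y & e = [set x; y]]) (e \in cycle_edges c).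
Proof.
move=> sc; apply: (iffP imsetP) => [[x xc ->]|[x [y [xc xy ->]]]].
  by exists x, (next c x); split=> //; apply: adj_next.
move: xy; rewrite (adjE _ sc xc) => /orP[]/eqP->; first by exists x.
exists (prev c x); first by rewrite mem_prev.
by rewrite next_prev ?simple_cycle_uniq // setUC.
Qed.

Lemma sub_closed c (A : {pred F}) x : cycle (@adj F) c -> x \in c -> x \in A ->
  (forall y z, y \in A -> adj y z -> z \in A) -> {subset c <= A}.
Proof.
move=> cc /rot_to[i s Ec] xA A_cl y; rewrite -(mem_rot i) Ec.
move: cc; rewrite -(rot_cycle i) Ec /= rcons_path => /andP[ps _].
rewrite inE => /orP[/eqP->//|]; elim: s x xA ps {Ec} => //= z s IH x xA /andP[xz ps].
have zA := A_cl _ _ xA xz.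
by rewrite inE => /orP[/eqP->//|]; apply: IH ps.
Qed.

Lemma cycle_eq_mem c c' x : simple_cycle c -> simple_cycle c' ->
  x \in c -> x \in c' -> c =i c'.
Proof.
move=> sc sc' xc xc' y; apply/idP/idP.
  have cc : cycle (@adj F) c by case/andP: sc => /andP[].
  by apply: (sub_closed cc xc) => // z t; apply: cycle_closed.
have cc : cycle (@adj F) c' by case/andP: sc' => /andP[].
by apply: (sub_closed cc xc') => // z t; apply: cycle_closed.
Qed.

Lemma eq_cycle_edges c c' : simple_cycle c -> simple_cycle c' ->
  c =i c' -> cycle_edges c = cycle_edges c'.
Proof.
move=> sc sc' E; apply/setP=> e.
by apply/(cycle_edgesE _ sc)/(cycle_edgesE _ sc') => -[x [y [xc xy ->]]];
   exists x, y; rewrite ?E // -E.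
Qed.

(** A simple path inside [A] is extended at its head until all neighbours of the head lie on it; by
    finiteness this happens, and a cycle closes. *)
Lemma exists_cycle (A : {set F}) : A != set0 ->
  (forall x y, x \in A -> adj x y -> y \in A) ->
  exists2 c, simple_cycle c & {subset c <= A}.
Proof.
move=> /set0Pn[x0 x0A] A_cl.
have grow k : (exists2 c, simple_cycle c & {subset c <= A}) \/
    exists x p, [/\ path (@adj F) x p, uniq (x :: p), {subset x :: p <= A} & size p = k].
  elim: k => [|k [|[x [p [pp Up pA sp]]]]]; [|by left|].
    by right; exists x0, [::]; split=> // y; rewrite inE => /eqP->.
  have [/subsetP sub|/subsetPn[w]] := boolP ([set y | adj x y] \subset p); last first.
    rewrite inE => xw wp; right; exists w, (x :: p).
    have wx : w != x by apply: contraTneq xw => ->; rewrite adj_irrefl.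
    split; rewrite /= ?sp //; first by rewrite adj_sym xw.
      by rewrite inE negb_or wx wp; exact: Up.
    move=> y; rewrite inE => /orP[/eqP->|]; last exact: pA.
    by apply: A_cl xw; apply: pA; rewrite mem_head.
  left; case: p => [|y q] in pp Up pA sp sub *.
    have := F_reg x; rewrite (_ : [set y | adj x y] = set0) ?cards0 //.
    by apply/setP=> y; rewrite in_set0; apply/negP=> /sub.
  (* Besides its successor [y] the head has a second neighbour [w]. It lies farther along the path,
     so the cycle has length at least 3. *)
  have [w xw wy] : exists2 w, adj x w & w != y.
    have : 0 < #|[set z | adj x z] :\ y|.
      have := cardsD1 y [set z | adj x z]; rewrite F_reg; case: (y \in _); lia.
    by case/card_gt0P=> w; rewrite !inE => /andP[wy xw]; exists w.
  have wq : w \in q by have := sub w; rewrite !inE (negPf wy) => /(_ xw).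
  case/splitPr: wq pp Up pA sp sub => q1 q2 pp Up pA sp sub.
  exists [:: x, y & rcons q1 w].
    rewrite /simple_cycle /ucycleb /= size_rcons andbT.
    move: pp; rewrite /= -cat_rcons cat_path => /and3P[-> pq _].
    rewrite rcons_path pq last_rcons adj_sym xw /=.
    move: Up; rewrite -cat_rcons -!cat_cons cat_uniq => /and3P[].
    by rewrite /= => ->.
  move=> z zc; apply: pA; rewrite -cat_rcons -!cat_cons mem_cat.
  by rewrite zc.
case: (grow #|F|) => // -[x [p [_ Up _ sp]]].
by have := max_card (mem (x :: p)); rewrite (card_uniqP Up) /= sp ltnn.
Qed.

(** Removing the vertices of a cycle from a set closed under adjacency leaves a closed set, so
    cycles are peeled off one by one. *)
Lemma cycle_decomposition : exists cs : seq (seq F),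
  [/\ all simple_cycle cs, uniq (flatten cs) & forall x, x \in flatten cs].
Proof.
suff [cs [scs Ucs Ecs]] : exists cs, [/\ all simple_cycle cs, uniq (flatten cs)
    & flatten cs =i [set: F]].
  by exists cs; split=> // x; rewrite Ecs inE.
have: forall x y : F, x \in [set: F] -> adj x y -> y \in [set: F] by [].
have [k] := ubnP #|[set: F]|; elim: k [set: F] => // k IH A leA A_cl.
have [->|A_neq0] := eqVneq A set0; first by exists [::]; split=> // x; rewrite inE.
have [c sc cA] := exists_cycle A_neq0 A_cl.
pose B := A :\: [set x in c].
have [|x y|cs [scs Ucs Ecs]] := IH B.
- rewrite -ltnS; apply: leq_trans leA; rewrite ltnS; apply: proper_card.
  rewrite properEneq subsetDl andbT; apply: contraTneq sc => EB.
  case: c cA @B EB => [|x c] cA B EB //.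
  have : x \in A by apply: cA; rewrite mem_head.
  by rewrite -EB !inE eqxx.
- rewrite !inE => /andP[xc xA] xy; rewrite (A_cl _ _ xA xy) andbT.
  by apply: contra xc => yc; apply: (cycle_closed sc yc); rewrite adj_sym.
exists (c :: cs); split=> [||x] /=; first by rewrite sc.
  rewrite cat_uniq (simple_cycle_uniq sc) Ucs andbT /=.
  by apply/hasPn=> x; rewrite Ecs !inE => /andP[].
by rewrite mem_cat Ecs !inE; case: (boolP (x \in c)) => // /cA ->.
Qed.

Section Count.
Variables (cs : seq (seq F)).
Hypotheses (cs_simple : all simple_cycle cs) (cs_uniq : uniq (flatten cs)).
Hypothesis (cs_cover : forall x, x \in flatten cs).

(** Every cycle of [F] has the vertex set, hence the edge set, of a member of [cs]; distinct members
    are disjoint and so have distinct edge sets. *)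
Lemma nu_count m : nu m F = count_mem m (shape cs).
Proof.
pose s := [seq cycle_edges c | c <- cs & size c == m].
have simple c : c \in cs -> simple_cycle c by move=> /(allP cs_simple).
have Us : uniq s.
  rewrite map_inj_in_uniq => [|c c'].
    rewrite filter_uniq // uniq_of_flatten //.
    by apply/negP=> /simple/andP[].
  rewrite !mem_filter => /andP[_ ccs] /andP[_ ccs'] E.
  case: c => [|x c] in ccs E *; first by case/andP: (simple _ ccs).
  apply: (uniq_flatten_eq cs_uniq ccs ccs' (mem_head x c)).
  have : [set x; next (x :: c) x] \in cycle_edges c'.
    by rewrite -E; apply: imset_f; rewrite mem_head.
  case/imsetP=> y yc' /setP/(_ x); rewrite !inE eqxx /= => /esym/orP[]/eqP->//.
  by rewrite mem_next.
have Es : cycles F m =i s.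
  move=> A; apply/idP/mapP => [|[c]].
    rewrite inE => /andP[m_gt2 /existsP[c /andP[cc /eqP->]]].
    have sc : simple_cycle c by rewrite /simple_cycle cc size_tuple.
    have [x xc] : exists x, x \in tval c.
      by case: (tval c) sc => [/andP[]|x c0] // _; exists x; rewrite mem_head.
    have /flattenP[c' cs_c' xc'] := cs_cover x.
    have Ec := cycle_eq_mem sc (simple _ cs_c') xc xc'.
    exists c'; last exact: eq_cycle_edges (simple _ cs_c') Ec.
    rewrite mem_filter cs_c' andbT -(size_tuple c); apply/eqP/esym/perm_size.
    apply: uniq_perm Ec; first exact: simple_cycle_uniq.
    exact: simple_cycle_uniq (simple _ cs_c').
  rewrite mem_filter => /andP[/eqP sz_c /simple/andP[cc c_gt2]] ->.
  rewrite inE -sz_c c_gt2; apply/existsP; exists (in_tuple c).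
  by rewrite cc eqxx.
rewrite /nu (eq_card Es) (card_uniqP Us) size_map size_filter count_map.
exact: eq_count.
Qed.
(** With each cycle oriented by its list, every edge is [[set x; succ x]] for exactly one vertex
    [x]. *)
Lemma sum_cycle_edges (e : {set F}) :
  \sum_(c <- cs) csum (fun x y => ([set x; y] == e) : nat) c = (e \in sedges F).
Proof.
have simple c : c \in cs -> simple_cycle c by move=> /(allP cs_simple).
(* The default [[::]] is never reached, since [cs] covers all vertices. *)
pose cyc x := nth [::] cs (find (fun c => x \in c) cs).
have cyc_cs x : cyc x \in cs /\ x \in cyc x.
  have h : has (fun c : seq F => x \in c) cs.
    by apply/hasP; have /flattenP[c ? ?] := cs_cover x; exists c.
  split; first by apply: mem_nth; rewrite -has_find.
  exact: (nth_find [::] h).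
have cyc_eq c x : c \in cs -> x \in c -> cyc x = c.
  move=> ccs xc; have [ccs' xc'] := cyc_cs x.
  exact: (uniq_flatten_eq cs_uniq ccs' ccs xc' xc).
pose succ x := next (cyc x) x.
have succ_cyc x : cyc (succ x) = cyc x.
  by have [? ?] := cyc_cs x; apply: cyc_eq => //; rewrite mem_next.
have succ2 x : succ (succ x) != x.
  have [/simple sc xc] := cyc_cs x.
  by rewrite /succ succ_cyc next_next_neq ?simple_cycle_uniq //; case/andP: sc.
have -> : \sum_(c <- cs) csum (fun x y => ([set x; y] == e) : nat) c
    = \sum_x ([set x; succ x] == e).
  transitivity (\sum_(x <- flatten cs) ([set x; succ x] == e)); last first.
    rewrite [RHS](perm_big (flatten cs)) //=.
    apply: uniq_perm; rewrite ?index_enum_uniq // => x.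
    by rewrite mem_index_enum cs_cover.
  rewrite big_flatten; apply: eq_big_seq => c ccs.
  rewrite csum_next ?simple_cycle_uniq ?simple //.
  by apply: eq_big_seq => x xc; rewrite /succ (cyc_eq c).
have one x : \sum_y ([set y; succ y] == [set x; succ x]) = 1.
  rewrite (bigD1 x) //= eqxx big1 // => y yx; apply/eqP; rewrite eqb0.
  (* Otherwise [x] and [y] would be successors of each other, against [succ2]. *)
  apply: contra (yx) => /eqP/setP E.
  have := E y; rewrite !inE eqxx (negPf yx) /= => /esym/eqP Ey.
  have := E x; rewrite !inE eqxx eq_sym (negPf yx) /= Ey => /eqP Ex.
  by have := succ2 x; rewrite -Ex eqxx.
have [|e_notin] := boolP (e \in sedges F).
  rewrite inE => /existsP[x /existsP[y /andP[xy /eqP->]]].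
  have [/simple sc xc] := cyc_cs x.
  move: xy; rewrite (adjE _ sc xc) => /orP[]/eqP->; first exact: one.
  rewrite -[RHS]/1 -(one (prev (cyc x) x)) setUC; apply: eq_bigr => z _.
  have Ep : cyc (prev (cyc x) x) = cyc x.
    by apply: cyc_eq; [case: (cyc_cs x) | rewrite mem_prev].
  by rewrite /succ Ep next_prev ?simple_cycle_uniq.
rewrite big1 // => x _; apply/eqP; rewrite eqb0; apply: contra e_notin => /eqP<-.
rewrite inE; apply/existsP; exists x; apply/existsP; exists (succ x).
by rewrite eqxx andbT; have [/simple sc xc] := cyc_cs x; apply: adj_next.
Qed.

End Count.
End TwoRegular.

(** * From labellings to factorisations *)

Lemma inj_surj_bij (T T' : finType) (f : T -> T') :
  injective f -> (forall y, exists x, f x = y) -> bijective f.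
Proof.
move=> f_inj f_surj; apply: inj_card_bij => //; rewrite -(card_codom f_inj).
apply: subset_leq_card; apply/subsetP=> y _.
by have [x <-] := f_surj y; apply: codom_f.
Qed.

Lemma preimset_eqE (T T' : finType) (f : T -> T') (A : {set T}) (B : {set T'}) :
  bijective f -> (A == f @^-1: B) = (f @: A == B).
Proof.
move=> f_bij; have f_inj := bij_inj f_bij; case: f_bij => g fK gK.
apply/eqP/eqP => [->|<-]; apply/setP=> z; last by rewrite inE mem_imset.
by rewrite -[z]gK mem_imset // inE.
Qed.

(** The [lam] copies of a pair are matched with the labellings that place an edge of [F] on it; each
    labelling thus collects one copy of every edge of its image of [F]. *)
Lemma factorisation_of_labellings (lam n : nat) (F : sgraph) (K : finType)
    (f : K -> F -> 'I_n) :
  (forall k, bijective (f k)) ->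
  (forall e : {set 'I_n}, #|e| = 2 -> \sum_k (f k @^-1: e \in sedges F) = lam) ->
  has_factorisation (complete_mgraph lam n) F.
Proof.
move=> f_bij sum_lam; pose S (e : {set 'I_n}) := [set k | f k @^-1: e \in sedges F].
have cardS (e : {e : {set 'I_n} | #|e| == 2}) : lam = #|S (val e)|.
  rewrite -(sum_lam (val e)); last exact/eqP/(valP e).
  rewrite -sum1_card [RHS]big_mkcond /=; apply: eq_bigr => k _.
  by rewrite [k \in _]in_set; case: (_ \in sedges F).
(* Copy number [i] of a pair goes to the [i]-th element of its set [S]. *)
pose kappa (x : medge (complete_mgraph lam n)) : K :=
  enum_val (cast_ord (cardS x.1) x.2).
have kappaP x : f (kappa x) @^-1: val x.1 \in sedges F.
  by have := enum_valP (cast_ord (cardS x.1) x.2); rewrite inE.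
have kappa_inj x y : x.1 = y.1 -> kappa x = kappa y -> x = y.
  case: x y => [e i] [e' j] /= E; move: E j => <- j.
  by rewrite /kappa /= => /enum_val_inj/cast_ord_inj->.
exists (preim_partition kappa setT); split; first exact: preim_partitionP.
move=> B /imsetP[x0 _ EB].
have inB x : (x \in B) = (kappa x0 == kappa x) by rewrite EB !inE.
have [g fK gK] := f_bij (kappa x0).
have imP (u : medge (spanning_subgraph B)) :
    f (kappa x0) @^-1: val (val u).1 \in sedges F.
  by have := valP u; rewrite /= inB => /eqP->.
(* The isomorphism onto [F] undoes the labelling on vertices and takes preimages of edges. *)
exists g, (fun u : medge (spanning_subgraph B) =>
  (Sub (f (kappa x0) @^-1: val (val u).1) (imP u) : medge (mgraph_of F))).
split; first by exists (f (kappa x0)).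
- apply: inj_surj_bij => [u v /(congr1 val) /= E|e].
    have E1 : val (val u).1 = val (val v).1.
      have f_surj (A : {set 'I_n}) : f (kappa x0) @: (f (kappa x0) @^-1: A) = A.
        by apply/eqP; rewrite -preimset_eqE.
      by rewrite -[LHS]f_surj E f_surj.
    have /val_inj {}E1 := E1.
    apply: val_inj.
    have := valP u; have := valP v; rewrite /= !inB => /eqP kv /eqP ku.
    by apply: kappa_inj; rewrite // -ku.
  have f_inj := can_inj fK.
  have card_e : #|f (kappa x0) @: val e| == 2.
    rewrite card_imset //; have := valP e; rewrite /= inE.
    case/existsP=> x /existsP[y /andP[xy /eqP->]]; rewrite cards2.
    by have -> // : x != y; apply: contraTneq xy => ->; rewrite adj_irrefl.
  have preK : f (kappa x0) @^-1: (f (kappa x0) @: val e) = val e.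
    by apply/eqP; rewrite eq_sym preimset_eqE.
  pose e1 : {e : {set 'I_n} | #|e| == 2} := Sub (f (kappa x0) @: val e) card_e.
  have kS : kappa x0 \in S (val e1) by rewrite inE /= preK; apply: (valP e).
  (* For surjectivity: the copy of the image of [e] that is assigned to [kappa x0]. *)
  pose x : medge (complete_mgraph lam n) :=
    (e1, cast_ord (esym (cardS e1)) (enum_rank_in kS (kappa x0))).
  have xB : x \in B by rewrite inB /kappa /= cast_ordKV enum_rankK_in.
  by exists (Sub x xB); apply: val_inj; rewrite /= preK.
- by move=> u /=; rewrite (can2_imset_pre _ gK fK).
Qed.

Lemma set2_eq (T : finType) (a b c d : T) :
  a != b -> [set a; b] = [set c; d] -> (a = c /\ b = d) \/ (a = d /\ b = c).
Proof.
move=> ab E; have := set22 a b; have := set21 a b.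
by rewrite E !inE => /orP[]/eqP Ea /orP[]/eqP Eb; auto; rewrite Ea Eb eqxx in ab.
Qed.

(** * Multiples of a difference modulo [p] *)

Definition residue (p x : nat) (p_gt0 : 0 < p) : 'I_p := Ordinal (ltn_pmod x p_gt0).

Lemma residue_eq p x y (p_gt0 : 0 < p) :
  residue x p_gt0 = residue y p_gt0 <-> x = y %[mod p].
Proof. by split=> [[]//|E]; apply: val_inj. Qed.

Lemma modn_mull_inj p d x y : prime p -> 0 < d < p ->
  d * x = d * y %[mod p] -> x = y %[mod p].
Proof.
move=> p_pr /andP[d_gt0 d_lt].
wlog le_yx : x y / y <= x => [H E|].
  by case: (leqP y x) => [/H/(_ E)//|/ltnW/H]; rewrite E => /(_ erefl).
move/eqP; rewrite !eqn_mod_dvd // ?leq_mul2l ?le_yx ?orbT // -mulnBr.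
rewrite Euclid_dvdM // gtnNdvd //= => dvd; apply/eqP.
by rewrite eqn_mod_dvd.
Qed.

(** For a fixed difference [s] the pairs obtained are distinct, and there are as many of them as
    2-subsets of ['I_p]. The multiplier is [d.+1] because ordinals start at 0. *)
Lemma sum_multiples p (p_gt0 : 0 < p) r s (e : {set 'I_p}) :
  prime p -> odd p -> 0 < s < p -> #|e| = 2 ->
  \sum_(d < p./2) \sum_(i < p)
    ([set residue (d.+1 * (i + r)) p_gt0; residue (d.+1 * (i + r + s)) p_gt0] == e) = 1.
Proof.
move=> p_pr p_odd s_bd card_e.
have d_bd (d : 'I_p./2) : 0 < d.+1 < p by have := ltn_ord d; lia.
pose g (x : 'I_p./2 * 'I_p) : {set 'I_p} :=
  [set residue (x.1.+1 * (x.2 + r)) p_gt0; residue (x.1.+1 * (x.2 + r + s)) p_gt0].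
have no_dvd m : 0 < m < p -> ~ (m * s = 0 %[mod p]).
  move=> m_bd; rewrite -(muln0 m) => /(modn_mull_inj p_pr m_bd).
  by rewrite mod0n modn_small; lia.
have g_neq (x : 'I_p./2 * 'I_p) :
    residue (x.1.+1 * (x.2 + r)) p_gt0 != residue (x.1.+1 * (x.2 + r + s)) p_gt0.
  apply/eqP=> /residue_eq; rewrite (mulnDr _ (_ + r) s) -{1}[_ * (_ + r)]addn0 => /eqP.
  by rewrite eqn_modDl => /eqP/esym; apply: no_dvd.
have g_inj : injective g.
  (* Equal pairs match in the same or the opposite order. The former forces [d = d'], then [i = i'];
     the latter makes [d.+1 + d'.+1] vanish modulo [p], although it lies strictly between 0 and
     [p]. *)
  move=> [d i] [d' i'] /(set2_eq (g_neq _)) /= [] [/residue_eq E1 /residue_eq E2].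
    have Ed : d = d'.
      apply/val_inj; move: E2; rewrite !(mulnDr _ (_ + r) s) -modnDml E1 modnDml => /eqP.
      rewrite eqn_modDl ![_ * s]mulnC => /eqP/(modn_mull_inj p_pr s_bd).
      by case/andP: (d_bd d) (d_bd d') => _ ? /andP[_ ?]; rewrite !modn_small // => -[].
    congr (_, _); first exact: Ed.
    apply/val_inj; move: E1; rewrite Ed => /(modn_mull_inj p_pr (d_bd d'))/eqP.
    by rewrite eqn_modDr !modn_small // => /eqP.
  have /no_dvd[] : 0 < d.+1 + d'.+1 < p by have := ltn_ord d; have := ltn_ord d'; lia.
  apply/eqP; rewrite -(eqn_modDl (d'.+1 * (i' + r))) addn0 mulnDl.
  by rewrite (addnC (d.+1 * s)) addnA -mulnDr -modnDml -E1 modnDml -mulnDr E2.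
have e_im : e \in g @: setT.
  suff -> : g @: setT = [set A : {set 'I_p} | #|A| == 2] by rewrite inE card_e.
  apply/eqP; rewrite eqEcard card_draws card_imset // cardsT card_prod !card_ord.
  apply/andP; split; last by rewrite bin2; nia.
  by apply/subsetP=> _ /imsetP[x _ ->]; rewrite inE cards2 g_neq.
have /imsetP[x _ ->] := e_im.
rewrite pair_bigA /= (bigD1 x) //= eqxx big1 // => y yx.
by apply/eqP; rewrite eqb0; apply: contra yx => /eqP/g_inj->.
Qed.

(** * Labelling the vertices of [F] by a gadget *)

(** Serves to reorder the cycles of a gadget so that their lengths match those of [cs] one by
    one. *)
Lemma perm_map_lift (T T' : eqType) (f : T -> T') (s : seq T) (t : seq T') :
  perm_eq (map f s) t -> exists2 s', perm_eq s' s & map f s' = t.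
Proof.
elim: t s => [|y t IH] s st.
  by exists s => //; apply/perm_nilP.
have /mapP[x xs Ey] : y \in map f s by rewrite (perm_mem st) mem_head.
have xs' := perm_to_rem xs.
have /IH[s' s's <-] : perm_eq (map f (rem x s)) t.
  rewrite -(perm_cons y) {1}Ey -map_cons; apply: perm_trans st.
  by apply: perm_map; rewrite perm_sym.
exists (x :: s'); last by rewrite /= Ey.
by rewrite perm_sym (perm_trans xs') // perm_cons perm_sym.
Qed.

Lemma count_sum (T : Type) (a : pred T) s : count a s = \sum_(x <- s) a x.
Proof. by rewrite -sum1_count big_mkcond; apply: eq_bigr => x _; case: (a x). Qed.

(** For a weight that depends only on the residue modulo [p], the debts at both ends coincide and
    cancel. *)
Lemma covers_residues p T C : covers p T T C ->
  perm_eq (map (modn^~ p) (flatten C)) (iota 0 p).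
Proof.
move=> cov; apply/permP=> a; have := cov (fun x => a (x %% p)).
have -> : \sum_(x <- T) a ((p + x) %% p) = \sum_(x <- T) a (x %% p).
  by apply: eq_bigr => x _; rewrite modnDl.
move/addIn; rewrite /vsum -big_flatten count_map !count_sum => ->.
rewrite -[p in iota 0 p]subn0 -/(index_iota 0 p) big_mkord.
by apply: eq_bigr => i _; rewrite modn_small.
Qed.

(** Reading the cycles of the gadget alongside those of [F] defines [g]. Its values stay natural
    numbers, so the edge identity of the gadget still applies; only injectivity is taken modulo
    [p]. *)
Lemma labelling (F : sgraph) (cs : seq (seq F)) p T C :
  uniq (flatten cs) -> (forall x, x \in flatten cs) ->
  covers p T T C -> perm_eq (shape C) (shape cs) ->
  exists g : F -> nat, (forall x y, g x = g y %[mod p] -> x = y) /\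
    forall phi, \sum_(c <- cs) csum (fun x y => phi (g x) (g y)) c = esum phi C.
Proof.
move=> Ucs cs_cover cov /perm_map_lift[C' C'C shC'].
have sz : size (flatten C') = size (flatten cs) by rewrite !size_flatten -shC'.
have [g /(_ Ucs sz) Eg] := map_of_seq (flatten cs) (flatten C') 0.
exists g; split=> [|phi].
  suff: injective (fun x => g x %% p) by move=> + x y; apply.
  apply/injectiveP; rewrite /injectiveb /dinjectiveb.
  have /(perm_map (fun x => g x %% p))/perm_uniq -> : perm_eq (enum F) (flatten cs).
    by apply: uniq_perm; rewrite ?enum_uniq // => x; rewrite cs_cover mem_enum.
  rewrite (map_comp (modn^~ p) g) Eg.
  have /(perm_map (modn^~ p))/perm_uniq -> := perm_flatten C'C.
  by rewrite (perm_uniq (covers_residues cov)) iota_uniq.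
rewrite /esum -(perm_big _ C'C) /=.
have -> : C' = map (map g) cs.
  apply: eq_from_flatten_shape; first by rewrite -map_flatten Eg.
  rewrite [LHS]shC' /shape -map_comp; apply: eq_map => c /=.
  by rewrite size_map.
by rewrite big_map; apply: eq_bigr => c _; rewrite csum_map.
Qed.

Theorem theorem31 (p : nat) (F : sgraph) :
  prime p -> odd p ->
  regular 2 F -> #|F| = p ->
  nu 3 F <= nu 5 F + \sum_(7 <= i < p.+1) nu i F ->
  has_factorisation (complete_mgraph 3 p) F.
Proof.
move=> p_pr p_odd F_reg card_F nu_le.
have [cs [cs_simple cs_uniq cs_cover]] := cycle_decomposition F_reg.
have nuE := nu_count F_reg cs_simple cs_uniq cs_cover.
have sum_cs : sumn (shape cs) = p.
  rewrite -size_flatten -(card_uniqP cs_uniq) -card_F.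
  by apply: eq_card => x; rewrite cs_cover.
have cs_ge3 : all (leq 3) (shape cs).
  by rewrite all_map; apply: sub_all cs_simple => c /andP[].
have le_count : count_mem 3 (shape cs) <= count long (shape cs).
  rewrite -nuE (leq_trans nu_le) // nuE.
  rewrite (eq_bigr (fun i => count_mem i (shape cs))) => [|i _]; last exact: nuE.
  rewrite (_ : \sum_(7 <= i < p.+1) _ = count (fun m => 6 < m < p.+1) (shape cs)).
    (* No length is both 5 and at least 7, so the two counts add up to that of the union. *)
    rewrite -count_predUI addnC (_ : count (predI _ _) _ = 0); last first.
      by apply/eqP; rewrite -leqn0 leqNgt -has_count; apply/hasPn => m _ /=; lia.
    by apply: sub_count => m /=; rewrite /long; lia.
  elim: (shape cs) => [|m ms IH] /=; first by rewrite big1.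
  rewrite big_split /= IH; congr (_ + _).
  have -> : \sum_(7 <= i < p.+1) (m == i) = \sum_(7 <= i < p.+1 | i == m) 1.
    by rewrite [RHS]big_mkcond; apply: eq_bigr => i _; rewrite eq_sym; case: eqP.
  by rewrite big_nat1_eq; case: ifP.
(* For [p = 3] the graph would be a single triangle without a partner. The bound makes 3 a nonzero
   difference modulo [p]. *)
have p_gt3 : 3 < p.
  rewrite ltn_neqAle (odd_prime_gt2 p_odd p_pr) andbT; apply/eqP=> p3.
  case: (shape cs) sum_cs cs_ge3 le_count => [|m [|m' ms]] /=; rewrite -?p3 //.
    by rewrite addn0 => ->.
  by move=> E /and3P[? ? _]; lia.
have [C0 [C1 [C2 [[cov0 cov1 cov2 edges] s0 s1 s2]]]] :=
  realizable_of_counts cs_ge3 le_count.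
rewrite {}sum_cs in cov0 cov1 cov2 edges.
have [g0 [g0_inj g0E]] := labelling cs_uniq cs_cover cov0 s0.
have [g1 [g1_inj g1E]] := labelling cs_uniq cs_cover cov1 s1.
have [g2 [g2_inj g2E]] := labelling cs_uniq cs_cover cov2 s2.
have p_gt0 := prime_gt0 p_pr.
have f_bij (d : 'I_p./2) (g : F -> nat) : (forall x y, g x = g y %[mod p] -> x = y) ->
    bijective (fun x => residue (d.+1 * g x) p_gt0).
  move=> g_inj; apply: inj_card_bij; last by rewrite card_F card_ord.
  move=> x y /residue_eq /(modn_mull_inj p_pr) E; apply: g_inj; apply: E.
  by have := ltn_ord d; lia.
pose g (j : 'I_3) := nth g0 [:: g0; g1; g2] j.
apply: (@factorisation_of_labellings 3 p F ('I_p./2 * 'I_3)%type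
  (fun k x => residue (k.1.+1 * g k.2 x) p_gt0)) => [[d j]|e card_e].
  by apply: f_bij; case: j => [[|[|[|]]]].
rewrite -(pair_bigA _ (fun (d : 'I_p./2) (j : 'I_3) =>
  ((fun x => residue (d.+1 * g j x) p_gt0) @^-1: e \in sedges F) : nat)) /=.
(* The multiplication by [d.+1] is absorbed into the weight, so that the one edge identity of the
   gadget serves for every [d]. *)
pose phi d x y : nat :=
  [set residue (d.+1 * x) p_gt0; residue (d.+1 * y) p_gt0] == e.
have edgeE (d : 'I_p./2) (h : F -> nat) : (forall x y, h x = h y %[mod p] -> x = y) ->
    ((fun x => residue (d.+1 * h x) p_gt0) @^-1: e \in sedges F) =
    \sum_(c <- cs) csum (fun x y => phi d (h x) (h y)) c :> nat.
  move=> h_inj; rewrite -(sum_cycle_edges F_reg cs_simple cs_uniq cs_cover).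
  apply: eq_bigr => c _; apply: eq_csum => x y.
  by rewrite preimset_eqE ?imsetU1 ?imset_set1 //; apply: f_bij.
transitivity (\sum_(d < p./2) window (phi d) p).
  apply: eq_bigr => d _; rewrite -edges => [|x y]; last by rewrite /phi setUC.
  rewrite !big_ord_recl big_ord0 addn0 /= !edgeE //.
  by rewrite g0E g1E g2E addnA.
have sum1 r s : 0 < s < p ->
    \sum_(d < p./2) \sum_(i < p) phi d (i + r) (i + r + s) = 1.
  by move=> s_bd; apply: sum_multiples.
have [lt1 lt2] : 1 < p /\ 2 < p by lia.
(* The window is split into the differences 1, 2 and 3, with starts shifted by 0, 1 and 0; each
   contributes 1 to the total. *)
transitivity (\sum_(d < p./2) (\sum_(i < p) phi d (i + 0) (i + 0 + 1)
  + \sum_(i < p) phi d (i + 1) (i + 1 + 2) + \sum_(i < p) phi d (i + 0) (i + 0 + 3))).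
  apply: eq_bigr => d _; rewrite -!big_split; apply: eq_bigr => i _ /=.
  by rewrite !addn0 !addn1 addn2 addn3.
by rewrite !big_split /= !sum1.
Qed.
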